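(* Let $m$ be a positive integer. Every Ferrers board $B$ is $m$-level rook equivalent to a unique $m$-increasing board.
   Context: A Ferrers board $B=(b_1,\dots,b_n)$ ($0\le b_1\le\dots\le b_n$ integers) is the set of cells consisting of the $b_j$ lowest cells of column $j$ in the first-quadrant grid of unit cells (so columns of height $0$ on the left do not change the board). The $i$th level consists of rows $(i-1)m+1,\dots,im$. An $m$-level rook placement is a set of cells of $B$ no two in the same level or column; $r_{k,m}(B)$ counts those with $k$ cells. Boards $B,B'$ are $m$-level rook equivalent if $r_{k,m}(B)=r_{k,m}(B')$ for all $k\ge0$. A Ferrers board $(b_1,\dots,b_n)$ is $m$-increasing if $b_1>0$ and $b_{j+1}\ge b_j+m$ for all $1\le j<n$. *)

(* Defs.v *)
From mathcomp Require Import all_boot.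

Set Implicit Arguments.
Unset Strict Implicit.
Unset Printing Implicit Defensive.

(* A board is given by its sequence of column heights, from left to right.
   The sequence may be empty: the board without cells is [::], and also any
   [:: 0; ...; 0]. *)
Definition ferrers (B : seq nat) : bool := sorted leq B.

(* A cell is a pair (column, row). Columns and rows are numbered from 0, so
   row i (row i + 1 in the 1-based numbering) lies in level i %/ m. *)
Definition grid (B : seq nat) : finType :=
  ('I_(size B) * 'I_(\max_(b <- B) b))%type.

Definition cells (B : seq nat) : {set grid B} :=
  [set c : grid B | c.2 < nth 0 B c.1].

Definition level (m : nat) (B : seq nat) (c : grid B) : nat := c.2 %/ m.

Definition rook_placement (m : nat) (B : seq nat) (P : {set grid B}) : bool :=
  (P \subset cells B) &&
  [forall c in P, forall d in P,
     (c != d) ==> (c.1 != d.1) && (level m c != level m d)].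

Definition rook_number (m : nat) (B : seq nat) (k : nat) : nat :=
  #|[set P : {set grid B} | rook_placement m P & #|P| == k]|.

Definition rook_equivalent (m : nat) (B B' : seq nat) : Prop :=
  forall k : nat, rook_number m B k = rook_number m B' k.

(* The default value 1 of head makes the condition b_1 > 0 vacuous on the
   empty sequence. Since all columns of an m-increasing board are nonempty, such
   a board is determined by its set of cells. *)
Definition m_increasing (m : nat) (B : seq nat) : bool :=
  [&& ferrers B, 0 < head 1 B & sorted (fun b b' => b + m <= b') B].

(* Main.v *)
(** Append columns from left to right and call zone a maximal run of columns
    with the same number [q] of full levels. Weighting a placement with [k] rooks
    in a board of [n] columns by [x (x - m) ... (x - (n - k - 1) m)], and
    recording whether the partial level [q] is used, one finds that the total
    weight is a product of linear factors [x - c_j], one for each column: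
    [c_j = (j - q) m] for the [j]-th column (counted from 0), minus the sum of all
    the remainders [b_i %% m] of the zone if the column is the last of its zone.
    The weights being monic of distinct degrees, this product determines the rook
    numbers and is determined by them.

    The roots [c_j] rise by [m] inside a zone and do not rise past their previous
    value, before subtraction of the remainders, at the start of a new one. Hence
    if some root is at least [k m] then [k m] is a root. For [p] minimal
    such that all roots are below [p m], the roots thus consist of
    [0, m, ..., (p - 1) m] and a remaining multiset. An [m]-increasing board
    preceded by [p] empty columns has roots [0, m, ..., (p - 1) m] followed by
    the weakly decreasing sequence of the [(p + j) m - b_j], all below [p m]: this
    is one and only one way to order the given multiset of roots. *)

Require Import Defs.
From mathcomp Require Import all_boot all_order all_algebra.
From mathcomp Require Import zify ring.
Import Order.TTheory GRing.Theory Num.Theory.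

Set Implicit Arguments.
Unset Strict Implicit.
Unset Printing Implicit Defensive.

(** * Placements as lists with one entry per column *)

Definition levels (m : nat) (s : seq (option nat)) : seq nat :=
  pmap (omap (divn^~ m)) s.

Definition choices (m b : nat) (s : seq (option nat)) : seq (option nat) :=
  None :: [seq Some r | r <- iota 0 b & r %/ m \notin levels m s].

(* The columns are listed from right to left, so that the head of [C] is the
   last column of the board; the entry [Some r] is a rook in row [r]. *)
Fixpoint placements (m : nat) (C : seq nat) : seq (seq (option nat)) :=
  if C is b :: C' then
    [seq o :: s | s <- placements m C', o <- choices m b s]
  else [:: [::]].

Lemma uniq_placements m C : uniq (placements m C).
Proof.
elim: C => // b C IH.
apply: (@allpairs_uniq_dep _ (fun=> option nat) _ (fun s o => o :: s)) => //.
- move=> s _ /=; apply/andP; split; first by apply/mapP => -[].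
  by rewrite map_inj_uniq ?filter_uniq ?iota_uniq // => x y [].
- by move=> [s o] [s' o'] _ _ /= [-> ->].
Qed.

Definition fits (o : option nat) (b : nat) : bool :=
  if o is Some r then r < b else true.

Lemma mem_placements m C s :
  (s \in placements m C) =
  all2 fits s C && uniq (levels m s).
Proof.
elim: C s => [|b C IH] [|o s] //.
  by apply/allpairsPdep => -[x] [y] [].
rewrite (_ : all2 _ _ _ = fits o b && all2 fits s C) //.
apply/allpairsPdep/idP => [[s'] [o'] [s'P o'P [-> ->]]|].
  move: s'P; rewrite IH /= => /andP[-> us]; move: o'P; rewrite inE.
  case/predU1P => [->|/mapP[r]] //=.
  rewrite mem_filter mem_iota add0n => /andP[rs /= rb] ->.
  by rewrite /= rb rs us.
case/andP=> /andP[ob sC] us; exists s, o; split=> //.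
  by rewrite IH sC; case: o us {ob} => //= r /andP[].
case: o ob us => [r|] //= rb /andP[rs _]; rewrite inE map_f ?orbT //.
by rewrite mem_filter rs mem_iota add0n.
Qed.

(** * Correspondence between placements as sets and as lists *)

Lemma uniq_pmap (I J : eqType) (g : I -> option J) (e : seq I) : uniq e ->
  reflect {in e &, forall i j x, g i = Some x -> g j = Some x -> i = j}
          (uniq (pmap g e)).
Proof.
elim: e => [|i e IH] //=; first by move=> _; apply: ReflectT.
case/andP=> ie /IH {}IH; case gi: (g i) => [x|] /=; last first.
  apply: (iffP IH) => H j k; rewrite ?inE.
    case/predU1P=> [->|je]; case/predU1P=> [->|ke] y gj gk //.
    - by rewrite gi in gj.
    - by rewrite gi in gk.
    - exact: H gj gk.
  by move=> je ke; apply: H; rewrite inE ?je ?ke orbT.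
apply: (iffP andP) => [[xe /IH H] j k|H]; last first.
  split; last by apply/IH => j k je ke; apply: H; rewrite inE ?je ?ke orbT.
  rewrite mem_pmap; apply/mapP => -[j je gj]; move/negP: ie; apply.
  by rewrite (H i j _ _ x) ?inE ?eqxx ?je ?orbT.
have nx l : l \in e -> g l <> Some x.
  by move=> le gl; case/negP: xe; rewrite mem_pmap -gl map_f.
rewrite !inE; case/predU1P=> [->|je]; case/predU1P=> [->|ke] y gj gk //.
- by case: (nx k) => //; rewrite gk -gj.
- by case: (nx j) => //; rewrite gj -gk.
- exact: H gj gk.
Qed.

Lemma all2_rev (S T : Type) (p : S -> T -> bool) s t :
  size s = size t -> all2 p (rev s) (rev t) = all2 p s t.
Proof. by move=> st; rewrite !all2E !size_rev -rev_zip // all_rev. Qed.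

Section Encoding.
Variables (m : nat) (B : seq nat).
Implicit Type P : {set grid B}.

Definition rook_in P (i : 'I_(size B)) : option nat :=
  omap val [pick r | (i, r) \in P].

(** Reversed because [placements] lists the columns from right to left. *)
Definition encode P : seq (option nat) :=
  rev [seq rook_in P i | i <- enum 'I_(size B)].

Lemma all2_nth (s : seq (option nat)) (p : option nat -> nat -> bool) :
  size s = size B ->
  all2 p s B = [forall i : 'I_(size B), p (nth None s i) (nth 0 B i)].
Proof.
move: B => B'; elim: s B' => [|o s IH] [|b B'] //= => [_|[/IH ->]].
  by apply/esym/forallP => -[].
apply/andP/forallP => [[pb /forallP H] i|H].
  by case: i => -[|i] //= lti; apply: (H (Ordinal (lti : i < size B'))).
split; first exact: (H ord0).
by apply/forallP => i; apply: (H (lift ord0 i)).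
Qed.

Lemma rook_inP P i r : rook_placement m P ->
  reflect (rook_in P i = Some (val r)) ((i, r) \in P).
Proof.
case/andP=> _ /forall_inP HP; apply: (iffP idP) => [irP|].
  rewrite /rook_in; case: pickP => [r' ir'P /=|/(_ r)]; last by rewrite irP.
  have /forall_inP/(_ _ irP)/implyP := HP _ ir'P.
  case: (altP eqP) => [[->]|_ /(_ isT)] //=; by rewrite eqxx.
rewrite /rook_in; case: pickP => [r' ir'P /= [/val_inj <-]|] //.
Qed.

Lemma rook_in_Some P i x : rook_in P i = Some x ->
  exists2 r, x = val r & (i, r) \in P.
Proof. by rewrite /rook_in; case: pickP => //= r irP [<-]; exists r. Qed.

Lemma levels_encode P :
  levels m (encode P) =
  rev (pmap (fun i => omap (divn^~ m) (rook_in P i)) (enum 'I_(size B))).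
Proof.
rewrite /encode /levels; elim: (enum _) => //= i e IH.
rewrite rev_cons -cats1 pmap_cat IH /=.
by case: (rook_in P i) => [x|] /=; rewrite ?cats0 ?rev_cons ?cats1.
Qed.

Lemma encode_placement P : rook_placement m P ->
  encode P \in placements m (rev B).
Proof.
move=> HP; rewrite mem_placements; apply/andP; split.
  have sz : size [seq rook_in P i | i <- enum 'I_(size B)] = size B.
    by rewrite size_map size_enum_ord.
  rewrite (all2_rev _ sz) (all2_nth _ sz).
  apply/forallP => i; rewrite (nth_map i) ?size_enum_ord ?nth_ord_enum //.
  case E: (rook_in P i) => [x|] //; case: (rook_in_Some E) => r -> irP.
  case/andP: HP => /subsetP/(_ _ irP); by rewrite inE.
rewrite levels_encode rev_uniq; apply/uniq_pmap; first exact: enum_uniq.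
move=> i j _ _ x; case Ei: (rook_in P i) => [y|] //= [yx].
case Ej: (rook_in P j) => [z|] //= [zx].
have [r Er irP] := rook_in_Some Ei; have [r' Er' jr'P] := rook_in_Some Ej.
case/andP: HP => _ /forall_inP/(_ _ irP)/forall_inP/(_ _ jr'P)/implyP.
case: eqP => [[]|_ /(_ isT)] //=.
by rewrite /level /= -Er -Er' yx zx eqxx andbF.
Qed.

Lemma encode_inj : {in @rook_placement m B &, injective encode}.
Proof.
move=> P Q HP HQ /(congr1 rev); rewrite !revK => E.
have {}E i : rook_in P i = rook_in Q i.
  by move/eq_in_map: E; apply; rewrite mem_enum.
by apply/setP => -[i r]; apply/(rook_inP _ _ HP)/(rook_inP _ _ HQ); rewrite E.
Qed.

(** A placement projects injectively to its columns, so both sides count the columns that hold a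
    rook. *)
Lemma size_levels_encode P : rook_placement m P ->
  size (levels m (encode P)) = #|P|.
Proof.
move=> HP; rewrite levels_encode size_rev size_pmap.
have inj : {in P &, injective fst}.
  move=> c d cP dP cd; case/andP: HP => _ /forall_inP/(_ _ cP).
  move/forall_inP/(_ _ dP)/implyP; case: eqP => // _ /(_ isT).
  by rewrite cd eqxx.
rewrite -(card_in_imset inj) -sum1_card -sum1_count big_enum_cond /=.
apply: eq_bigl => i; apply/idP/imsetP => [|[[j r] jrP /= ->]].
  by case E: (rook_in P i) => [x|] //;
  case: (rook_in_Some E) => r _ irP; exists (i, r).
by move/(rook_inP _ _ HP): jrP => ->.
Qed.

Lemma encode_surj s : s \in placements m (rev B) ->
  exists2 P, rook_placement m P & encode P = s.
Proof.
rewrite mem_placements => /andP[sB us].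
have sz : size s = size B.
  by rewrite -[RHS]size_rev; apply/eqP; move: sB; rewrite all2E => /andP[].
pose s' := rev s; have sz' : size s' = size B by rewrite size_rev.
pose P : {set grid B} := [set c : grid B | nth None s' c.1 == Some (val c.2)].
have {}sB : forall i : 'I_(size B), fits (nth None s' i) (nth 0 B i).
  by apply/forallP; rewrite -(all2_nth fits sz') -all2_rev ?size_rev ?revK ?sz.
have PE i : rook_in P i = nth None s' i.
  rewrite /rook_in; case: pickP => [r|noP]; first by rewrite inE /= => /eqP ->.
  have := sB i; case E: (nth None s' i) => [x|] // xb.
  (* A row below the height of some column is below the maximal height, hence is a row of the
     grid. *)
  have xM : x < \max_(b <- B) b.
    by apply: (leq_trans xb); apply: leq_bigmax_seq; rewrite ?mem_nth.
  by have := noP (Ordinal xM); rewrite inE /= E eqxx.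
have enc : encode P = s.
  rewrite /encode (eq_map PE) -[s]revK -/s'; congr rev.
  rewrite (map_comp (nth None s') val) val_enum_ord map_nth_iota0 ?sz' //.
  by rewrite -sz' take_size.
exists P => //; apply/andP; split.
  apply/subsetP => -[i r]; rewrite !inE /= => /eqP E.
  by have := sB i; rewrite E.
move: us; rewrite -enc levels_encode rev_uniq => /uniq_pmap.
move/(_ (enum_uniq _)) => inj.
apply/forall_inP => -[i r] irP; apply/forall_inP => -[j r'] jr'P.
apply/implyP => ne; move: irP jr'P; rewrite !inE /= => /eqP Ei /eqP Ej.
have ij : i != j.
  by apply: contra ne => /eqP ij; move: Ej; rewrite -ij Ei => -[/val_inj ->].
rewrite ij /=; apply: contra ij => /eqP lv.
apply/eqP/(inj i j _ _ (r %/ m)); rewrite ?mem_enum // PE ?Ei ?Ej //=.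
by rewrite [in RHS](lv : r %/ m = r' %/ m).
Qed.

Lemma rook_numberE k :
  rook_number m B k =
  count (fun s => size (levels m s) == k) (placements m (rev B)).
Proof.
pose A := [set P : {set grid B} | rook_placement m P].
have perm : perm_eq (placements m (rev B)) [seq encode P | P <- enum A].
  apply: uniq_perm; rewrite ?uniq_placements //.
    rewrite map_inj_in_uniq ?enum_uniq // => P Q; rewrite !mem_enum !inE.
    exact: encode_inj.
  move=> s; apply/idP/mapP => [/encode_surj[P HP <-]|[P]].
    by exists P; rewrite ?mem_enum ?inE.
  by rewrite mem_enum inE => /encode_placement H ->.
rewrite (permP perm) count_map /rook_number -sum1_card -sum1_count.
rewrite big_enum_cond /=; apply: eq_bigl => P; rewrite !inE /=.
by case HP: (rook_placement m P) => //=; rewrite size_levels_encode.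
Qed.

End Encoding.

(** * Weighted sums over placements *)

Local Open Scope ring_scope.

Definition falling (m k : nat) : {poly int} :=
  \prod_(i <- iota 0 k) ('X - (i * m)%:Z%:P).

Lemma fallingS m k :
  falling m k.+1 = falling m k * ('X - (k * m)%:Z%:P).
Proof. by rewrite /falling -addn1 iotaD big_cat big_seq1. Qed.

Definition blanks (s : seq (option nat)) : nat := count (fun o => ~~ isSome o) s.

(* [d] counts the empty columns added to the left of the board. *)
Definition rook_poly (m d : nat) (C : seq nat) : {poly int} :=
  \sum_(s <- placements m C) falling m (d + blanks s).

(** In a zone, the next column meets level [q] only partially, so its number of free rows depends on
    whether [q] is used; hence the sum is split. *)
Definition avoiding_poly (m d q : nat) (C : seq nat) : {poly int} :=
  \sum_(s <- placements m C | q \notin levels m s) falling m (d + blanks s).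

Definition using_poly (m d q : nat) (C : seq nat) : {poly int} :=
  \sum_(s <- placements m C | q \in levels m s) falling m (d + blanks s).

Lemma rook_poly_split m d q C :
  rook_poly m d C = using_poly m d q C + avoiding_poly m d q C.
Proof. by rewrite /rook_poly (bigID (fun s => q \in levels m s)). Qed.

Lemma blanks_levels m s : (blanks s + size (levels m s))%N = size s.
Proof.
rewrite /levels size_pmap addnC -[RHS](count_predC isSome); congr addn.
by apply: eq_count => -[].
Qed.

Lemma size_placement m C s : s \in placements m C -> size s = size C.
Proof. by rewrite mem_placements all2E => /andP[/andP[/eqP]]. Qed.

(** * Effect of appending a column *)

Lemma sum_block (V : nmodType) (m l r : nat) (lv : seq nat) (f : nat -> V) :
  (r <= m)%N ->
  \sum_(x <- iota (l * m) r | (x %/ m)%N \notin lv) f (x %/ m)%N =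
  if l \notin lv then f l *+ r else 0.
Proof.
move=> rm; have lE x : x \in iota (l * m) r -> (x %/ m)%N = l.
  by rewrite mem_iota => /andP[lx xr]; nia.
rewrite big_seq_cond (eq_bigl (fun x => (x \in iota (l * m) r) && (l \notin lv))).
  rewrite (eq_bigr (fun=> f l)) => [|x /andP[/lE -> _] //].
  rewrite -big_seq_cond big_const_seq iter_addr_0.
  by case: ifP => _; rewrite ?count_predT ?size_iota ?count_pred0.
by move=> x; case xI: (x \in _) => //=; rewrite (lE _ xI).
Qed.

Lemma sum_rows (V : nmodType) (m q r : nat) (lv : seq nat) (f : nat -> V) :
  (r <= m)%N ->
  \sum_(x <- iota 0 (q * m + r) | (x %/ m)%N \notin lv) f (x %/ m)%N =
  (\sum_(l <- iota 0 q | l \notin lv) f l) *+ m +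
  (if q \notin lv then f q *+ r else 0).
Proof.
move=> rm; rewrite iotaD big_cat add0n /= sum_block //; congr (_ + _).
elim: q => [|q IH]; first by rewrite mul0n !big_nil mul0rn.
rewrite -addn1 mulnDl mul1n !iotaD !big_cat !add0n sum_block // IH.
rewrite [in RHS]/= big_cons big_nil mulrnDl.
by case: ifP => _; rewrite ?addr0 ?mul0rn.
Qed.

Lemma count_free_levels (q : nat) (lv : seq nat) : uniq lv ->
  (count (fun l => l \notin lv) (iota 0 q) + count (fun l => l < q) lv)%N = q.
Proof.
move=> us; rewrite -[RHS](size_iota 0) -[RHS](count_predC (mem lv)) addnC.
congr addn; rewrite -!size_filter; apply/perm_size/uniq_perm.
- by rewrite filter_uniq.
- by rewrite filter_uniq ?iota_uniq.
by move=> x; rewrite !mem_filter mem_iota add0n andbC.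
Qed.

Lemma count_lt_levels (q : nat) (lv : seq nat) :
  uniq lv -> all (fun l => l <= q)%N lv ->
  (count (fun l => l < q) lv + (q \in lv))%N = size lv.
Proof.
move=> us /allP le; rewrite -(count_uniq_mem q us).
rewrite -[RHS](count_predC (fun l => l < q)%N); congr addn.
by apply: eq_in_count => l /le; rewrite /= -leqNgt eqn_leq => ->.
Qed.

Lemma levels_lt m q C s : (0 < m)%N -> s \in placements m C ->
  all (fun b => b %/ m < q)%N C -> all (fun l => l < q)%N (levels m s).
Proof.
move=> m0; rewrite mem_placements => /andP[sC _].
elim: s C sC => [|[r|] s IH] [|b C] //= => [/andP[rb sC]|sC] /andP[bq Cq].
  rewrite (IH _ sC Cq) andbT; apply: leq_ltn_trans bq; exact/leq_div2r/ltnW.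
exact: IH sC Cq.
Qed.

Section AddColumn.
Variables (m d q r : nat) (C : seq nat).
Hypotheses (m_gt0 : (0 < m)%N) (rm : (r < m)%N).
Hypothesis Cq : all (fun b => b %/ m <= q)%N C.
Let b := (q * m + r)%N.
Let c : int := ((d + size C) * m)%:Z - (q * m)%:Z.

Lemma sum_choices (F : option nat -> {poly int}) s :
  \sum_(o <- choices m b s) F o =
  F None + \sum_(x <- iota 0 b | (x %/ m)%N \notin levels m s) F (Some x).
Proof. by rewrite big_cons big_map big_filter. Qed.

(** By [Cq] all rooks lie in levels up to [q], so the free levels below [q] number [q] minus the
    number of rooks, plus one if [q] itself is used. There are [size C - blanks s] rooks; [d] is
    added and subtracted to bring out the index of the weight. *)
Lemma free_levels s : s \in placements m C ->
  (count (fun l => l \notin levels m s) (iota 0 q))%:R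
  = q%:R - (d + size C)%:R + (d + blanks s)%:R + (q \in levels m s)%:R :> {poly int}.
Proof.
move=> sC; have us : uniq (levels m s).
  by move: sC; rewrite mem_placements => /andP[].
have e1 := count_free_levels q us.
have e2 := count_lt_levels us (levels_lt m_gt0 sC (q := q.+1) Cq).
have e3 := blanks_levels m s; have e4 := size_placement sC.
by rewrite -e4 -e3 -e2 -[in X in X - _]e1 !natrD; ring.
Qed.

Lemma polyC_posz n : (n%:Z)%:P = n%:R :> {poly int}.
Proof. by rewrite -natz polyC_natr. Qed.

(** Put [j = d + blanks s]. Leaving the new column empty multiplies the weight by [X - j m]; a rook
    in a full level keeps the weight and has [(q - (d + size C) + j) m] places. In the sum [j]
    cancels, so the factor is the same for all [s]. *)
Lemma avoiding_poly_cons :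
  avoiding_poly m d q (b :: C) = avoiding_poly m d q C * ('X - c%:P).
Proof.
rewrite /avoiding_poly big_mkcond big_allpairs_dep big_distrl /= [RHS]big_mkcond.
apply: eq_big_seq => s sC; rewrite sum_choices /=.
pose f l := if q \notin l :: levels m s then falling m (d + blanks s) else 0.
(* A rook in the partial level would use [q], so that level contributes nothing. *)
rewrite (sum_rows _ _ f (ltnW rm)) /f inE eqxx mul0rn if_same addr0.
rewrite big_seq_cond (eq_bigr (fun=> if q \notin levels m s
    then falling m (d + blanks s) else 0)); last first.
  move=> l /andP[]; rewrite mem_iota add0n => lq _; rewrite inE.
  by case: (altP (q =P l)) => // ql; move: lq; rewrite ql ltnn.
rewrite -big_seq_cond big_const_seq iter_addr_0.
have := free_levels sC; case: ifP => [qs H|_ _]; last by rewrite !mul0rn addr0.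
rewrite addnS fallingS -mulrnA -mulr_natr natrM H (negbTE qs) addr0 /c.
rewrite polyCB !polyC_posz !natrM; ring.
Qed.

(** Either the new rook is the one in level [q], in one of [r] rows, or [q] was used before. In the
    latter case one more level below [q] is free than in [avoiding_poly_cons], which shifts the root
    by [m]. *)
Lemma using_poly_cons :
  using_poly m d q (b :: C) =
  avoiding_poly m d q C * r%:R + using_poly m d q C * ('X - (c - m%:Z)%:P).
Proof.
rewrite /using_poly /avoiding_poly big_mkcond big_allpairs_dep !big_distrl /=.
rewrite [X in X + _]big_mkcond [X in _ + X]big_mkcond -big_split.
apply: eq_big_seq => s sC; rewrite sum_choices /=.
pose f l := if q \in l :: levels m s then falling m (d + blanks s) else 0.
rewrite (sum_rows _ _ f (ltnW rm)) /f inE eqxx.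
rewrite big_seq_cond (eq_bigr (fun=> if q \in levels m s
    then falling m (d + blanks s) else 0)); last first.
  move=> l /andP[]; rewrite mem_iota add0n => lq _; rewrite inE.
  by case: (altP (q =P l)) => // ql; move: lq; rewrite ql ltnn.
rewrite -big_seq_cond big_const_seq iter_addr_0.
have := free_levels sC; case: ifP => /= [qs H|_ _].
  rewrite addnS fallingS -mulrnA -mulr_natr natrM H mulr1n /c.
  rewrite !polyCB !polyC_posz !natrM; ring.
by rewrite !mul0rn !add0r mulr_natr addr0.
Qed.

End AddColumn.

(** * Roots contributed by the zones of a board *)

Lemma using_poly_new_level m d q C : (0 < m)%N ->
  all (fun b => b %/ m < q)%N C -> using_poly m d q C = 0.
Proof.
move=> m0 Cq; rewrite /using_poly big_seq_cond big1 // => s /andP[sC qs].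
by have /allP/(_ _ qs) := levels_lt m0 sC Cq; rewrite ltnn.
Qed.

Definition prod_roots (t : seq int) : {poly int} := \prod_(x <- t) ('X - x%:P).

Definition multiples_closed (m : nat) (t : seq int) : Prop :=
  forall x k, x \in t -> (k * m)%:Z <= x -> (k * m)%:Z \in t.

(* The last column [b] of the board [b :: C] need not end its zone: [rho] is the
   sum of the remainders met in the zone so far, [e] the root that the last column
   contributes if the zone continues, and [e - rho] if it ends here. *)
Definition zone_invariant (m b : nat) (C : seq nat) (t : seq int) (rho : nat) :=
  let q := (b %/ m)%N in
  let e := (size C * m)%:Z - (q * m)%:Z in
  [/\ size t = size C,
      avoiding_poly m 0 q (b :: C) = prod_roots t * ('X - e%:P),
      using_poly m 0 q (b :: C) = prod_roots t * rho%:R,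
      multiples_closed m t &
      forall k, (k * m)%:Z < e -> (k * m)%:Z \in t].

(** No earlier column reaches level [b %/ m], so level [b %/ m] can only be used by a rook in one of
    the [b %% m] top rows of the new column. *)
Lemma zone_new m b C t : (0 < m)%N ->
  all (fun b' => b' %/ m < b %/ m)%N C ->
  size t = size C -> rook_poly m 0 C = prod_roots t ->
  multiples_closed m t ->
  (forall k, (k * m)%:Z < (size C * m)%:Z - (b %/ m * m)%:Z ->
     (k * m)%:Z \in t) ->
  zone_invariant m b C t (b %% m).
Proof.
move=> m0 Cb st tE ct et; have Cb' : all (fun b' => b' %/ m <= b %/ m)%N C.
  by apply: sub_all Cb => x; apply: ltnW.
have U0 := using_poly_new_level 0 m0 Cb.
have tE' : avoiding_poly m 0 (b %/ m) C = prod_roots t.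
  by rewrite -tE (rook_poly_split m 0 (b %/ m)) U0 add0r.
have rm := ltn_pmod b m0; split=> //.
  by rewrite {2}(divn_eq b m) avoiding_poly_cons // tE'.
by rewrite {2}(divn_eq b m) using_poly_cons // tE' U0 mul0r addr0.
Qed.

(** With one more column and the same [q], the expected root becomes [e + m]. The shift by [m] in
    [using_poly_cons] brings it back to [e], the root just added to [t]; so both summands of the
    using part share the factor [X - e] and the remainders add up. *)
Lemma zone_extend m b b' C t rho : (0 < m)%N ->
  all (fun x => x %/ m <= b' %/ m)%N (b' :: C) ->
  (b %/ m = b' %/ m)%N -> zone_invariant m b' C t rho ->
  zone_invariant m b (b' :: C)
    (((size C * m)%:Z - (b' %/ m * m)%:Z) :: t) (b %% m + rho).
Proof.
rewrite /zone_invariant => m0 Cb bb [st aE uE ct et]; rewrite bb.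
have rm := ltn_pmod b m0.
have bE : b = (b' %/ m * m + b %% m)%N by rewrite -bb -divn_eq.
set e : int := _ - _ in aE et *.
have prod_cons : prod_roots (e :: t) = prod_roots t * ('X - e%:P).
  by rewrite /prod_roots big_cons mulrC.
split.
- by rewrite /= st.
- by rewrite {1}bE avoiding_poly_cons // aE prod_cons.
- rewrite {1}bE using_poly_cons // aE uE prod_cons /= natrD /e !add0n.
  by rewrite mulSn !polyCB PoszD polyCD !polyC_posz; ring.
- move=> x k; rewrite !inE => /predU1P[->|xt] kx; last by rewrite (ct x) ?orbT.
  by move: kx; rewrite le_eqVlt => /predU1P[->|/et ->]; rewrite ?eqxx ?orbT.
move=> k /= ke; have kC : (k + b' %/ m < (size C).+1)%N.
  by rewrite -(ltn_pmul2r m0) mulnDl; lia.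
(* Here [k m < e + m], and [e] is a multiple of [m]. *)
have : (k * m)%:Z <= e by move: kC; rewrite ltnS -(leq_pmul2r m0) mulnDl /e; lia.
by rewrite le_eqVlt inE => /predU1P[->|/et ->]; rewrite ?eqxx ?orbT.
Qed.

(** The two parts add up to [prod_roots t] times [X - e + rho], so closing the zone lowers its last
    root by [rho]. *)
Lemma zone_rook_poly m b C t rho : zone_invariant m b C t rho ->
  let e := (size C * m)%:Z - (b %/ m * m)%:Z in
  [/\ rook_poly m 0 (b :: C) = prod_roots ((e - rho%:Z) :: t),
      multiples_closed m ((e - rho%:Z) :: t) &
      forall k, (k * m)%:Z < e -> (k * m)%:Z \in (e - rho%:Z) :: t].
Proof.
case=> st aE uE ct et e; split.
- rewrite (rook_poly_split m 0 (b %/ m)) aE uE /prod_roots big_cons.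
  by rewrite !polyCB !polyC_posz; ring.
- move=> x k; rewrite !inE => /predU1P[->|xt] kx; last by rewrite (ct x) ?orbT.
  case: (ltP (k * m)%:Z e) => [/et ->|ek]; first by rewrite orbT.
  (* Now [e <= k m <= e - rho], which forces equality. *)
  by apply/orP; left; apply/eqP; lia.
by move=> k /et kt; rewrite inE kt orbT.
Qed.

Lemma rook_poly_factorization m C : (0 < m)%N -> sorted geq C ->
  exists t, [/\ size t = size C, rook_poly m 0 C = prod_roots t &
                 multiples_closed m t].
Proof.
move=> m0; case: C => [_|b C].
  exists [::]; split=> //.
  by rewrite /rook_poly /prod_roots big_seq1 /falling !big_nil.
move=> sC; suff [t [rho H]] : exists t rho, zone_invariant m b C t rho.
  have [? ? ?] := zone_rook_poly H; eexists; split; eauto.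
  by case: H => /= ->.
elim: C b sC => [|b' C IH] b /=.
  move=> _; exists [::], (b %% m)%N; apply: zone_new => //.
    by rewrite /rook_poly /prod_roots big_seq1 /falling !big_nil.
  by move=> k; rewrite mul0n; move: (k * m)%N (b %/ m * m)%N => x y; lia.
case/andP=> b'b sC; have [t [rho H]] := IH _ sC.
have le : all (fun x => x %/ m <= b' %/ m)%N (b' :: C).
  rewrite /= leqnn; have : all (geq b') C.
    by apply: order_path_min sC => x y z xy yz; apply: leq_trans xy.
  by apply: sub_all => x; apply: leq_div2r.
have := leq_div2r m b'b; rewrite leq_eqVlt => /predU1P[bb|bb].
  by do 2!eexists; apply: zone_extend H.
have [tE ct et] := zone_rook_poly H.
do 2!eexists; apply: zone_new tE ct _ => //.
- by apply: sub_all le => x xb; apply: leq_ltn_trans bb.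
- by case: H => /= ->.
(* The extra column raises the expected root by [m], and the jump in the number of full levels
   lowers it by at least [m]. *)
by move=> k ke; apply: et; move: ke => /=; nia.
Qed.

(** * Roots of an [m]-increasing board *)

Definition increasing_roots (m d : nat) : seq nat -> seq int :=
  fix roots C := if C is b :: C' then
    ((d + size C') * m)%:Z - b%:Z :: roots C' else [::].

Definition zero_roots (m d : nat) : seq int :=
  [seq (i * m)%:Z | i <- iota 0 d].

(** Heights at least [m] apart have different numbers of full levels, so each column is a zone by
    itself: its root loses [q m] and its own remainder, in total its height. The [d] empty columns
    give the roots of [falling m d]. *)
Lemma rook_poly_increasing m d C : (0 < m)%N ->
  sorted (fun b b' => b' + m <= b)%N C ->
  rook_poly m d C = prod_roots (zero_roots m d ++ increasing_roots m d C).
Proof.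
move=> m0; elim: C => [_|b C IH sC].
  by rewrite cats0 /rook_poly /prod_roots big_seq1 addn0 big_map.
have lt : all (fun x => x %/ m < b %/ m)%N C.
  have : all (fun x => x + m <= b)%N C.
    by apply: order_path_min sC => x y z xy yz; lia.
  apply: sub_all => x /(leq_div2r m).
  by rewrite divnDr ?dvdnn // divnn m0 addn1.
have le : all (fun x => x %/ m <= b %/ m)%N C.
  by apply: sub_all lt => x; apply: ltnW.
have rm := ltn_pmod b m0.
have aE : avoiding_poly m d (b %/ m) C = rook_poly m d C.
  by rewrite (rook_poly_split m d (b %/ m)) using_poly_new_level ?add0r.
have u0 := using_poly_new_level d m0 lt.
rewrite (rook_poly_split m d (b %/ m)).
move: (IH (path_sorted sC)) (divn_eq b m) rm aE u0 lt le => tE {sC}.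
move: (b %/ m)%N (b %% m)%N => q r -> rm aE u0 lt le {b}.
rewrite avoiding_poly_cons // using_poly_cons // aE u0 tE.
rewrite /prod_roots !big_cat /= big_cons PoszD !polyCB polyCD !polyC_posz.
by ring.
Qed.

(** * Rook numbers and roots determine each other *)

Lemma size_levels_le m C s :
  s \in placements m C -> (size (levels m s) <= size C)%N.
Proof. by move/size_placement <-; rewrite -(blanks_levels m s) leq_addl. Qed.

Lemma rook_number_big m B k : (size B < k)%N -> rook_number m B k = 0%N.
Proof.
move=> Bk; rewrite rook_numberE; apply/eqP; rewrite -leqn0 leqNgt -has_count.
apply/hasPn => s /size_levels_le; rewrite size_rev => le.
by apply: contraL Bk => /eqP <-; rewrite -leqNgt.
Qed.

Lemma rook_polyE m d B :
  rook_poly m d (rev B) =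
  \sum_(k < (d + size B).+1) falling m (d + size B - k) *+ rook_number m B k.
Proof.
pose F s k := if size (levels m s) == k then falling m (d + size B - k) else 0.
transitivity (\sum_(s <- placements m (rev B)) \sum_(k < (d + size B).+1) F s k).
  apply: eq_big_seq => s sB; have le := size_levels_le sB.
  rewrite size_rev in le.
  have lt : (size (levels m s) < (d + size B).+1)%N by lia.
  rewrite (bigD1 (Ordinal lt)) //= big1 ?addr0; last first.
    by move=> k /negP nk; rewrite /F; case: eqP => // E; case: nk; apply/eqP/val_inj.
  rewrite /F eqxx; congr falling.
  have := blanks_levels m s; rewrite (size_placement sB) size_rev; lia.
rewrite exchange_big; apply: eq_bigr => k _.
by rewrite -big_mkcond big_const_seq iter_addr_0 rook_numberE.
Qed.

Lemma size_falling m k : size (falling m k) = k.+1.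
Proof. by rewrite /falling size_prod_XsubC size_iota. Qed.

Lemma coef_falling_lead m k : (falling m k)`_k = 1.
Proof.
have := monic_prod_XsubC (iota 0 k) predT (fun i => (i * m)%:Z).
by rewrite monicE lead_coefE -/(falling m k) size_falling => /eqP.
Qed.

(** Triangularity: the coefficient of degree [N] involves only the term of index 0, which is then
    cancelled. *)
Lemma falling_free m N (a b : nat -> nat) :
  \sum_(k < N.+1) falling m (N - k) *+ a k =
  \sum_(k < N.+1) falling m (N - k) *+ b k ->
  forall k, (k <= N)%N -> a k = b k.
Proof.
elim: N a b => [|N IH] a b.
  rewrite !big_ord1 => /(congr1 (fun p : {poly int} => p`_0)).
  rewrite !coefMn coef_falling_lead => /eqP.
  by rewrite eqr_nat => /eqP ab k; rewrite leqn0 => /eqP ->.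
have tail0 (c : nat -> nat) :
    (\sum_(i < N.+1) falling m (N.+1 - lift ord0 i) *+ c (lift ord0 i))`_N.+1 = 0.
  rewrite coef_sum big1 // => i _; rewrite coefMn nth_default ?mul0rn //.
  by rewrite size_falling lift0 subSS ltnS leq_subr.
rewrite !(big_ord_recl N.+1) /= subn0 => E.
have ab0 : a 0%N = b 0%N.
  have /eqP := congr1 (fun p : {poly int} => p`_N.+1) E.
  by rewrite !coefD !tail0 !coefMn coef_falling_lead !addr0 eqr_nat => /eqP.
move: E; rewrite ab0 => /addrI E [|k] // kN.
by apply: (IH (fun i => a i.+1) (fun i => b i.+1)).
Qed.

(** Padding with empty columns gives both boards the same number of columns, so both expansions are
    in the same weights. *)
Lemma rook_equivalent_poly m d d' B B' : (d + size B = d' + size B')%N ->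
  rook_equivalent m B B' <->
  rook_poly m d (rev B) = rook_poly m d' (rev B').
Proof.
move=> dd; rewrite !rook_polyE -dd; split=> [E|/falling_free E k].
  by apply: eq_bigr => k _; rewrite E.
case: (leqP k (d + size B)) => [/E //|Bk].
by rewrite !rook_number_big //; lia.
Qed.

Lemma prod_roots_inj t t' : prod_roots t = prod_roots t' -> perm_eq t t'.
Proof.
(* Unique factorization is applied over the field of rationals. *)
move=> /(congr1 (map_poly (intr : int -> rat))); rewrite /prod_roots !rmorph_prod.
have E s : \prod_(x <- s) map_poly (intr : int -> rat) ('X - x%:P) =
           \prod_(y <- [seq x%:~R | x <- s]) ('X - y%:P).
  by rewrite big_map; apply: eq_bigr => x _; rewrite rmorphB /= map_polyX map_polyC.
by rewrite !E => /prod_XsubC_eq /perm_map_inj; apply; apply: intr_inj.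
Qed.

Lemma perm_prod_roots t t' : perm_eq t t' -> prod_roots t = prod_roots t'.
Proof. exact: perm_big. Qed.

(** * Uniqueness *)

Lemma m_increasing_rev m C :
  m_increasing m (rev C) =
  sorted (fun b b' => b' + m <= b)%N C && (0 < last 1 C)%N.
Proof.
have -> : last 1%N C = head 1%N (rev C).
  by case: (lastP C) => // s x; rewrite last_rcons rev_rcons.
rewrite /m_increasing /ferrers !rev_sorted [_ && (0 < _)%N]andbC.
case: (0 < _)%N; rewrite ?andbF //=; apply: andb_idl.
by apply: sub_sorted => x y /=; apply: leq_trans; rewrite leq_addr.
Qed.

(** The leftmost column has a root below [d m]. One column further right, the position adds [m] and
    the height takes away at least [m], so the roots do not rise. *)
Lemma increasing_roots_lt m d C :
  sorted (fun b b' => b' + m <= b)%N C -> (0 < last 1 C)%N ->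
  all (fun x => x < (d * m)%:Z) (increasing_roots m d C).
Proof.
elim: C => // b [|b' C] IH /=; first by rewrite addn0; lia.
case/andP=> bb sC lC; have /= /andP[H ->] := IH sC lC.
by rewrite H !andbT addnS mulSn; lia.
Qed.

Lemma zero_roots_lt m d : (0 < m)%N ->
  all (fun x => x < (d * m)%:Z) (zero_roots m d).
Proof.
move=> m0; apply/allP => x /mapP[i]; rewrite mem_iota => /= id ->.
by rewrite ltz_nat ltn_pmul2r.
Qed.

Lemma increasing_roots_sorted m d C :
  sorted (fun b b' => b' + m <= b)%N C ->
  sorted <=%R (increasing_roots m d C).
Proof.
elim: C => // b [|b' C] IH //= /andP[bb sC].
by have /= -> := IH sC; rewrite andbT addnS mulSn; lia.
Qed.

Lemma increasing_roots_inj m d C C' :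
  increasing_roots m d C = increasing_roots m d C' -> C = C'.
Proof.
elim: C C' => [|b C IH] [|b' C'] //= [+ /IH E]; rewrite E.
by move=> H; congr cons; lia.
Qed.

(* [(p' - 1) m] is a root of the right hand side, while all those of the left
   hand side are below [p m]. *)
Lemma leq_zero_roots m p p' C C' : (0 < m)%N ->
  sorted (fun b b' => b' + m <= b)%N C -> (0 < last 1 C)%N ->
  perm_eq (zero_roots m p ++ increasing_roots m p C)
          (zero_roots m p' ++ increasing_roots m p' C') ->
  (p' <= p)%N.
Proof.
move=> m0 sC lC E; case: p' E => // p' E.
have : (p' * m)%:Z \in zero_roots m p ++ increasing_roots m p C.
  by rewrite (perm_mem E) mem_cat map_f ?mem_iota ?leqnn.
rewrite mem_cat => /orP[/(allP (zero_roots_lt p m0))|].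
  by rewrite ltz_nat ltn_pmul2r.
move/(allP (increasing_roots_lt p sC lC)).
by rewrite ltz_nat ltn_pmul2r.
Qed.

Lemma m_increasing_unique m B B' : (0 < m)%N ->
  m_increasing m B -> m_increasing m B' -> rook_equivalent m B B' -> B = B'.
Proof.
move=> m0; rewrite -[B]revK -[B']revK; move: (rev B) (rev B') => C C'.
rewrite !m_increasing_rev => /andP[sC lC] /andP[sC' lC'].
(* Truncated subtraction: only the board with fewer columns gets padded. *)
pose d := (size C' - size C)%N; pose d' := (size C - size C')%N.
have dd : (d + size (rev C) = d' + size (rev C'))%N.
  by rewrite !size_rev /d /d'; lia.
move/(rook_equivalent_poly m dd); rewrite !revK !rook_poly_increasing //.
move=> /prod_roots_inj E; have dE : d = d'.
  apply/eqP; rewrite eqn_leq (leq_zero_roots m0 sC lC E).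
  by rewrite perm_sym in E; rewrite (leq_zero_roots m0 sC' lC' E).
move: E; rewrite dE perm_cat2l => E; congr rev.
apply: (@increasing_roots_inj m d'); apply: (sorted_eq le_trans le_anti) E.
  exact: increasing_roots_sorted.
exact: increasing_roots_sorted.
Qed.

(** * Existence *)

Definition board_of_roots (m p : nat) : seq int -> seq nat :=
  fix board w := if w is c :: w' then
    `|((p + size w') * m)%:Z - c|%N :: board w' else [::].

Lemma size_board_of_roots m p w : size (board_of_roots m p w) = size w.
Proof. by elim: w => //= c w ->. Qed.

(** As all roots are below [p m], the differences in [board_of_roots] are positive and the absolute
    value does not alter them. *)
Lemma board_of_rootsK m p w : all (fun x => x < (p * m)%:Z) w ->
  increasing_roots m p (board_of_roots m p w) = w.
Proof.
elim: w => //= c w IH /andP[cp /IH ->]; congr cons.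
by rewrite size_board_of_roots mulnDl; lia.
Qed.

Lemma board_of_roots_increasing m p w : (0 < m)%N ->
  sorted <=%R w -> all (fun x => x < (p * m)%:Z) w ->
  m_increasing m (rev (board_of_roots m p w)).
Proof.
move=> m0 sw wp; rewrite m_increasing_rev; elim: w sw wp => //= c [|c' w] IH.
  by move=> _ /andP[cp _] /=; rewrite addn0; lia.
move=> /andP[cc' sw] /andP[cp wp]; have /= /andP[-> ->] := IH sw wp.
case/andP: wp => c'p _.
by rewrite !andbT /= addnS mulSn mulnDl; lia.
Qed.

Lemma extract_zero_roots m t : (0 < m)%N -> multiples_closed m t ->
  exists p w, [/\ perm_eq t (zero_roots m p ++ w), sorted <=%R w &
                  all (fun x => x < (p * m)%:Z) w].
Proof.
move=> m0 ct; pose P p := all (fun x => x < (p * m)%:Z) t.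
have exP : exists p, P p.
  exists (\max_(x <- t) `|x|).+1%N; apply/allP => x xt.
  have : (`|x| <= \max_(x <- t) `|x|)%N by apply: leq_bigmax_seq.
  by move: (\max_(x <- t) `|x|)%N => M; nia.
case: (ex_minnP exP) => p Pp minp.
have sub : {subset zero_roots m p <= t}.
  move=> x /mapP[i]; rewrite mem_iota add0n => /= ip ->.
  (* By minimality of [p] some root is at least [(p - 1) m], hence at least [i m] for every
     [i < p]. *)
  have : ~~ P p.-1 by apply/negP => /minp; lia.
  rewrite -has_predC => /hasP[x' x't] /=; rewrite -leNgt => le.
  apply: ct x't _; apply: le_trans le; rewrite lez_nat leq_pmul2r //; lia.
have uz : uniq (zero_roots m p).
  rewrite map_inj_uniq ?iota_uniq // => i j [/eqP].
  by rewrite eqn_pmul2r // => /eqP.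
(* Since the entries of [zero_roots m p] are distinct, their membership in [t] is enough to split
   them off as a multiset. *)
have [s ss zs] : exists2 s, subseq s t & perm_eq (zero_roots m p) s.
  apply/count_subseqP => x; rewrite count_uniq_mem //.
  by case: (boolP (x \in zero_roots m p)) => // /sub; rewrite -has_pred1 has_count.
have [w tw] := perm_to_subseq ss.
have tw' : perm_eq t (zero_roots m p ++ sort <=%R w).
  by apply: (perm_trans tw); apply: perm_cat; rewrite perm_sym ?perm_sort.
exists p, (sort <=%R w); split=> //; first exact/sort_sorted/le_total.
by move: Pp; rewrite /P (perm_all _ tw') all_cat => /andP[].
Qed.

Lemma m_increasing_exists m B : (0 < m)%N -> ferrers B ->
  exists2 B', m_increasing m B' & rook_equivalent m B B'.
Proof.
move=> m0 fB; have sB : sorted geq (rev B) by rewrite rev_sorted.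
have [t [st tE /(extract_zero_roots m0)[p [w [tw sw wp]]]]] :=
  rook_poly_factorization m0 sB.
have inc := board_of_roots_increasing m0 sw wp.
exists (rev (board_of_roots m p w)) => //.
(* There are as many roots as columns of [B]; [p] of them become empty columns and the others become
   columns of the new board. *)
have dd : (0 + size B = p + size (rev (board_of_roots m p w)))%N.
  rewrite size_rev size_board_of_roots -(size_rev B) -st (perm_size tw).
  by rewrite size_cat size_map size_iota.
apply/(rook_equivalent_poly m dd); rewrite revK tE (perm_prod_roots tw).
move: inc; rewrite m_increasing_rev => /andP[sC _].
by rewrite rook_poly_increasing // board_of_rootsK.
Qed.

Local Close Scope ring_scope.

Theorem theorem4p5 (m : nat) (m_gt0 : 0 < m) (B : seq nat) (hB : ferrers B) :
  exists! B' : seq nat, m_increasing m B' /\ rook_equivalent m B B'.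
Proof.
have [B' incB' BB'] := m_increasing_exists m_gt0 hB.
exists B'; split=> // B'' [incB'' BB'']; apply: (m_increasing_unique m_gt0) => //.
by move=> k; rewrite -BB' BB''.
Qed.
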